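(* Let $\eta\in\mathbb C\setminus\{0\}$, $\lambda_1,\lambda_2,\delta_1,\delta_2\in\mathbb C$, $I=K_{\lambda_1}\times K_{\lambda_2}$ and $g(x)=\delta_1-\delta_2+\eta(\lambda_1-\lambda_2+x)$. Assume all denominators below are nonzero, that is: $g(k-\ell)\neq0$ for all $(\ell,k)\in I$; $g(k-\ell-n)\ne0$ whenever $n\ge1$ and $(\ell,k),(\ell+n,k-n)\in I$; $g(-2\lambda_1+k)\neq0$ whenever $k,k+1\in K_{\lambda_2}$. Let $q_{\ell k}$, $(\ell,k)\in I$, be nonzero complex numbers satisfying the recursion relations $$\frac{q_{\ell k}}{q_{\ell-1,k}}=\frac{g(-\ell)}{g(k-\ell)},\qquad \frac{q_{\ell,k+1}}{q_{\ell k}}=\frac{g(k-\ell)}{g(-2\lambda_1+k)}$$ for all indices for which both coefficients on the left are indexed by elements of $I$. Define $$v_{\ell k}=q_{\ell k}\sum_{n=0}^{k}\frac{(-\eta)^n}{n!}\Bigl(\prod_{j=1}^n\frac{f^{(1)}_{\ell+j-1}\,e^{(2)}_{k-j+1}}{g(k-\ell-j)}\Bigr)|\ell+n,k-n\rangle .$$ Then for all $u\in\mathbb C$ and $(\ell,k)\in I$ the coproducts act on $V_{\lambda_1}(\delta_1)\otimes V_{\lambda_2}(\delta_2)$ by $$\Delta D(u)\,v_{\ell k}=d^{(1)}_\ell(u)\,d^{(2)}_k(u)\,v_{\ell k},$$ $$\Delta B(u)\,v_{\ell k}=\eta f^{(1)}_\ell d^{(2)}_k(u)\frac{g(2\lambda_2-\ell)}{g(k-\ell)}\,v_{\ell+1,k}+\eta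 d^{(1)}_\ell(u)f^{(2)}_k\frac{g(-2\lambda_1+k)}{g(k-\ell)}\,v_{\ell,k+1},$$ $$\Delta C(u)\,v_{\ell k}=\eta e^{(1)}_\ell d^{(2)}_k(u)\frac{g(-\ell)}{g(k-\ell)}\,v_{\ell-1,k}+\eta d^{(1)}_\ell(u)e^{(2)}_k\frac{g(k)}{g(k-\ell)}\,v_{\ell,k-1},$$ where terms with $v_{\ell' k'}$, $(\ell',k')\notin I$, are zero.
   Context: For $\lambda\in\mathbb C$, $V_\lambda$ is the highest weight $\mathfrak{sl}_2$-representation with basis $|k\rangle$, $k\in K_\lambda$, where $K_\lambda=\{0,\dots,2\lambda\}$ if $2\lambda\in\mathbb N_0$ and $K_\lambda=\mathbb N_0$ otherwise, and $H|k\rangle=(\lambda-k)|k\rangle$, $E|k\rangle=k|k-1\rangle$, $F|k\rangle=(2\lambda-k)|k+1\rangle$; $|k\rangle:=0$ if $k\notin K_\lambda$. The evaluation representation $V_\lambda(\delta)$ of the Yangian is $V_\lambda$ with the operators (for $u\in\mathbb C$) $A(u)=u-\delta+\eta H$, $B(u)=\eta F$, $C(u)=\eta E$, $D(u)=u-\delta-\eta H$. On $V_{\lambda_1}(\delta_1)\otimes V_{\lambda_2}(\delta_2)$ the coproduct is $\Delta A=A\otimes A+C\otimes B$, $\Delta B=B\otimes A+D\otimes B$, $\Delta C=A\otimes C+C\otimes D$, $\Delta D=B\otimes C+D\otimes D$ (all at the same $u$; the $j$-th tensor factor uses $\lambda_j,\delta_j$). Notation: $e^{(j)}_k=k$, $f^{(j)}_k=2\lambda_j-k$,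 $a^{(j)}_k(u)=u-\delta_j+\eta(\lambda_j-k)$, $d^{(j)}_k(u)=u-\delta_j-\eta(\lambda_j-k)$, $|\ell,k\rangle=|\ell\rangle\otimes|k\rangle$, which is zero if $(\ell,k)\notin K_{\lambda_1}\times K_{\lambda_2}$; terms of a sum whose basis vector is zero are omitted. *)

(* Defs.v *)
From HB Require Import structures.
From mathcomp Require Import all_boot all_order all_algebra.
From mathcomp Require Import boolp reals.
From mathcomp Require Export complex.
From mathcomp.multinomials Require Import freeg.

Set Implicit Arguments.
Unset Strict Implicit.
Unset Printing Implicit Defensive.

Import GRing.Theory.
Local Open Scope ring_scope.

Section Representation.
Context (R : realType).
Local Notation C := R[i].
Implicit Types (eta lam del u : C) (k : nat).

(* When 2 lam is a natural number it is real, and on reals the partial order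
   of R[i] is the usual one. *)
Definition K lam : pred nat := fun k =>
  if `[< exists m : nat, 2 * lam = m%:R >] then k%:R <= 2 * lam else true.

Definition Kidx lam : choiceType := {k : nat | K lam k}.

(* Finitely supported functions K_lam -> C *)
Definition V lam : lmodType C := {freeg (Kidx lam) / C}.

Definition basis_vec (I : choiceType) (i : I) : {freeg I / C} := << i >>.

(* |k>, equal to 0 when k is not in K_lam *)
Definition ket lam k : V lam :=
  if (insub k : option (Kidx lam)) is Some i then basis_vec i else 0.

Definition e k : C := k%:R.
Definition f lam k : C := 2 * lam - k%:R.
Definition a eta lam del k u : C := u - del + eta * (lam - k%:R).
Definition d eta lam del k u : C := u - del - eta * (lam - k%:R).

(* The operators are the linear extensions (fglift) of their values on the
   basis.  In opE the index (val k).-1 stands for k - 1: at k = 0 the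
   coefficient vanishes. *)
Definition opH lam : V lam -> V lam :=
  fglift (fun k : Kidx lam => (lam - (val k)%:R) *: ket lam (val k)).
Definition opE lam : V lam -> V lam :=
  fglift (fun k : Kidx lam => (val k)%:R *: ket lam (val k).-1).
Definition opF lam : V lam -> V lam :=
  fglift (fun k : Kidx lam => (2 * lam - (val k)%:R) *: ket lam (val k).+1).

Definition opA eta lam del u (x : V lam) : V lam :=
  (u - del) *: x + eta *: opH x.
Definition opB eta lam (x : V lam) : V lam := eta *: opF x.
Definition opC eta lam (x : V lam) : V lam := eta *: opE x.
Definition opD eta lam del u (x : V lam) : V lam :=
  (u - del) *: x - eta *: opH x.

(* The tensor product of two free modules is the free module on the product
   of the bases. *)
Definition tensor lam1 lam2 : lmodType C :=
  {freeg (Kidx lam1 * Kidx lam2)%type / C}.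

Definition tens_vec lam1 lam2 (x : V lam1) (y : V lam2) : tensor lam1 lam2 :=
  fglift (fun i : Kidx lam1 =>
    (fglift (fun j : Kidx lam2 => basis_vec (i, j)) y : tensor lam1 lam2)) x.

Definition tens_op lam1 lam2 (S : V lam1 -> V lam1) (T : V lam2 -> V lam2) :
    tensor lam1 lam2 -> tensor lam1 lam2 :=
  fglift (fun p : (Kidx lam1 * Kidx lam2)%type =>
    tens_vec (S (basis_vec p.1)) (T (basis_vec p.2))).

Definition ket2 lam1 lam2 (l k : nat) : tensor lam1 lam2 :=
  tens_vec (ket lam1 l) (ket lam2 k).

End Representation.

Arguments opH {R} lam x.
Arguments opE {R} lam x.
Arguments opF {R} lam x.
Arguments opA {R} eta lam del u x.
Arguments opB {R} eta lam x.
Arguments opC {R} eta lam x.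
Arguments opD {R} eta lam del u x.

Section Coproduct.
Context (R : realType) (eta lam1 lam2 del1 del2 : R[i]).
Local Notation C := R[i].
Implicit Types (u x : C) (l k : nat) (w : tensor lam1 lam2).

Definition DeltaA u w :=
  tens_op (opA eta lam1 del1 u) (opA eta lam2 del2 u) w
  + tens_op (opC eta lam1) (opB eta lam2) w.
Definition DeltaB u w :=
  tens_op (opB eta lam1) (opA eta lam2 del2 u) w
  + tens_op (opD eta lam1 del1 u) (opB eta lam2) w.
Definition DeltaC u w :=
  tens_op (opA eta lam1 del1 u) (opC eta lam2) w
  + tens_op (opC eta lam1) (opD eta lam2 del2 u) w.
Definition DeltaD u w :=
  tens_op (opB eta lam1) (opC eta lam2) w
  + tens_op (opD eta lam1 del1 u) (opD eta lam2 del2 u) w.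

Definition g x : C := del1 - del2 + eta * (lam1 - lam2 + x).

(* Extended by 0 outside K_lam1 x K_lam2.  A term of the sum with
   (l + n, k - n) outside this set is 0 whatever its coefficient, since its
   basis vector is 0; denominators g (k - l - j) may vanish only there. *)
Definition v (q : nat -> nat -> C) l k : tensor lam1 lam2 :=
  if K lam1 l && K lam2 k then
    q l k *: \sum_(0 <= n < k.+1)
      ((- eta) ^+ n / n`!%:R *
       \prod_(1 <= j < n.+1)
         (f lam1 (l + j - 1) * e R (k - j + 1) / g (k%:R - l%:R - j%:R)))
      *: ket2 lam1 lam2 (l + n) (k - n)
  else 0.

End Coproduct.

Arguments DeltaA {R} eta lam1 lam2 del1 del2 u w.
Arguments DeltaB {R} eta lam1 lam2 del1 del2 u w.
Arguments DeltaC {R} eta lam1 lam2 del1 del2 u w.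
Arguments DeltaD {R} eta lam1 lam2 del1 del2 u w.

(* Main.v *)
(* Write v_{lk} = q_{lk} w_{lk}, where w_{lk} is the sum of c_n(l,k) |l+n,k-n>.
   The coefficients satisfy the first-order recursion
     c_{n+1}(l,k) / c_n(l,k) = - eta f_{l+n} (k-n) / ((n+1) g(k-l-n-1)),
   and telescoping the products gives
     f_l c_n(l+1,k) / g(k-l-1) = c_n(l,k) f_{l+n} / g(k-l-n-1),
     k c_n(l,k-1) / g(k-l-1) = c_n(l,k) (k-n) / g(k-l-n-1).
   Hence in each of the three formulas the coefficients of a given basis vector
   on the two sides are c_n(l,k) times rational functions of l, k and n, and
   the formulas reduce to identities between these functions.  The recursion
   relations for q then absorb the remaining factors. *)
From HB Require Import structures.
Require Import Defs.
From mathcomp Require Import all_boot all_order all_algebra.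
From mathcomp Require Import boolp reals complex ring.
From mathcomp.multinomials Require Import freeg.

Set Implicit Arguments.
Unset Strict Implicit.
Unset Printing Implicit Defensive.

Import Order.TTheory GRing.Theory Num.Theory.
Local Open Scope ring_scope.

(** * Linear extension of maps from a basis *)

Section FreegLift.
Context (A : nzRingType) (M : lmodType A) (I : choiceType) (h : I -> M).

(** [lift_is_additive] concerns differences, so zero, opposites and sums are derived from it in
    turn; scaling is then compared term by term on the support. *)
Lemma fglift_linear : linear (fglift h).
Proof.
have lift0 : fglift h 0 = 0.
  by have := lift_is_additive h 0 0; rewrite !subrr.
have liftN D : fglift h (- D) = - fglift h D.
  by have := lift_is_additive h 0 D; rewrite lift0 !sub0r.
have liftD D1 D2 : fglift h (D1 + D2) = fglift h D1 + fglift h D2.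
  by rewrite -[in LHS](opprK D2) lift_is_additive liftN opprK.
have lift_sum (J : Type) (s : seq J) (P : J -> {freeg I / A}) :
    fglift h (\sum_(j <- s) P j) = \sum_(j <- s) fglift h (P j).
  exact: (big_morph _ liftD lift0).
move=> c D1 D2; rewrite liftD; congr (_ + _).
rewrite -[in RHS](freeg_sumE D1) !lift_sum scaler_sumr.
by apply: eq_bigr => i _; rewrite !liftU scalerA.
Qed.

HB.instance Definition _ :=
  GRing.isLinear.Build A {freeg I / A} M *:%R (fglift h) fglift_linear.

End FreegLift.

(** Linearity in the extended map rather than in its argument; this yields homogeneity of [tens_vec]
    in its second factor. *)
Lemma fglift_scale (A : comNzRingType) (M : lmodType A) (I : choiceType)
    (h h' : I -> M) c D :
  (forall i, h' i = c *: h i) -> fglift h' D = c *: fglift h D.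
Proof.
move=> h'E; rewrite -(freeg_sumE D) !linear_sum.
by apply: eq_bigr => i _ /=; rewrite !liftU h'E !scalerA mulrC.
Qed.

(** * Action of the operators on basis vectors *)

Section Operators.
Context (R : realType).
Local Notation C := R[i].
Implicit Types (eta lam del u : C) (m p : nat).

(** Trades the order of [R[i]] for that of the naturals; when [2 * lam] is not natural the condition
    is vacuous, so both branches of [K] are covered. *)
Lemma KP lam m :
  reflect (forall M : nat, 2 * lam = M%:R -> (m <= M)%N) (K lam m).
Proof.
rewrite /K; apply: (iffP idP) => [+ M E|le_m].
  by case: asboolP => [_|[]]; [rewrite E ler_nat | exists M].
by case: asboolP => // -[M E]; rewrite E ler_nat; apply: le_m.
Qed.

Lemma K_leq lam m p : (m <= p)%N -> K lam p -> K lam m.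
Proof. by move=> mp /KP Kp; apply/KP => M /Kp; apply: leq_trans. Qed.

(* A last index of K_lam can only be 2 lam. *)
Lemma f_last lam m : K lam m -> ~~ K lam m.+1 -> f lam m = 0.
Proof.
move=> /KP Km; rewrite /K /f; case: asboolP => // -[M E].
by rewrite E ler_nat -leqNgt => Mm; rewrite (@anti_leq m M) ?subrr ?Km.
Qed.

Lemma ketE lam m (Km : K lam m) : ket lam m = basis_vec R (Sub m Km : Kidx lam).
Proof. by rewrite /ket insubT. Qed.

Lemma ket0 lam m : ~~ K lam m -> ket lam m = 0.
Proof. by move=> nKm; rewrite /ket insubN. Qed.

Lemma opA_ket eta lam del u m : K lam m ->
  opA eta lam del u (ket lam m) = a eta lam del m u *: ket lam m.
Proof.
by move=> Km; rewrite /opA /opH ketE liftU scale1r /= -ketE scalerA -scalerDl.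
Qed.

Lemma opB_ket eta lam m : K lam m ->
  opB eta lam (ket lam m) = (eta * f lam m) *: ket lam m.+1.
Proof. by move=> Km; rewrite /opB /opF ketE liftU scale1r /= scalerA. Qed.

Lemma opC_ket eta lam m : K lam m ->
  opC eta lam (ket lam m) = (eta * m%:R) *: ket lam m.-1.
Proof. by move=> Km; rewrite /opC /opE ketE liftU scale1r /= scalerA. Qed.

Lemma opD_ket eta lam del u m : K lam m ->
  opD eta lam del u (ket lam m) = d eta lam del m u *: ket lam m.
Proof.
by move=> Km; rewrite /opD /opH ketE liftU scale1r /= -ketE scalerA -scalerBl.
Qed.

Context (lam1 lam2 : C).

Lemma tens_vecZ c c' (x : V lam1) (y : V lam2) :
  tens_vec (c *: x) (c' *: y) = (c * c') *: tens_vec x y.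
Proof.
rewrite /tens_vec linearZ -scalerA; congr (_ *: _).
by apply: fglift_scale => i; rewrite linearZ.
Qed.

Lemma ket2_0l m p : ~~ K lam1 m -> ket2 lam1 lam2 m p = 0.
Proof. by move=> /ket0 m0; rewrite /ket2 m0 /tens_vec linear0. Qed.

Lemma tens_op_ket2 (S : V lam1 -> V lam1) (T : V lam2 -> V lam2) m p :
  K lam1 m -> K lam2 p ->
  tens_op S T (ket2 lam1 lam2 m p) = tens_vec (S (ket lam1 m)) (T (ket lam2 p)).
Proof.
move=> Km Kp; rewrite /ket2 !ketE /tens_op {2}/tens_vec !liftU !scale1r.
by rewrite /= liftU scale1r.
Qed.

Lemma tens_op_is_linear (S : V lam1 -> V lam1) (T : V lam2 -> V lam2) :
  linear (tens_op S T).
Proof. exact: fglift_linear. Qed.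

HB.instance Definition _ (S : V lam1 -> V lam1) (T : V lam2 -> V lam2) :=
  GRing.isLinear.Build C (tensor lam1 lam2) (tensor lam1 lam2) *:%R
    (tens_op S T) (tens_op_is_linear S T).

Context (eta del1 del2 : C).
Local Notation DeltaB := (DeltaB eta lam1 lam2 del1 del2).
Local Notation DeltaC := (DeltaC eta lam1 lam2 del1 del2).
Local Notation DeltaD := (DeltaD eta lam1 lam2 del1 del2).
Local Notation a1 := (a eta lam1 del1).
Local Notation a2 := (a eta lam2 del2).
Local Notation d1 := (d eta lam1 del1).
Local Notation d2 := (d eta lam2 del2).
Local Notation ket2 := (ket2 lam1 lam2).

Lemma DeltaB_ket2 u m p : K lam1 m -> K lam2 p ->
  DeltaB u (ket2 m p) = (eta * f lam1 m * a2 p u) *: ket2 m.+1 p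
                      + (eta * d1 m u * f lam2 p) *: ket2 m p.+1.
Proof.
move=> Km Kp; rewrite /Defs.DeltaB !tens_op_ket2 // !opB_ket //.
by rewrite opA_ket // opD_ket // !tens_vecZ mulrCA mulrA.
Qed.

Lemma DeltaC_ket2 u m p : K lam1 m -> K lam2 p ->
  DeltaC u (ket2 m p) = (eta * a1 m u * p%:R) *: ket2 m p.-1
                      + (eta * m%:R * d2 p u) *: ket2 m.-1 p.
Proof.
move=> Km Kp; rewrite /Defs.DeltaC !tens_op_ket2 // !opC_ket //.
by rewrite opA_ket // opD_ket // !tens_vecZ mulrCA mulrA.
Qed.

Lemma DeltaD_ket2 u m p : K lam1 m -> K lam2 p ->
  DeltaD u (ket2 m p) = (eta ^+ 2 * f lam1 m * p%:R) *: ket2 m.+1 p.-1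
                      + (d1 m u * d2 p u) *: ket2 m p.
Proof.
move=> Km Kp; rewrite /Defs.DeltaD !tens_op_ket2 //.
rewrite opB_ket // opC_ket // !opD_ket // !tens_vecZ.
by rewrite expr2 mulrACA mulrA.
Qed.

Lemma DeltaB_linear u : linear (DeltaB u).
Proof. by move=> c x y; rewrite /Defs.DeltaB !linearP scalerDr addrACA. Qed.

Lemma DeltaC_linear u : linear (DeltaC u).
Proof. by move=> c x y; rewrite /Defs.DeltaC !linearP scalerDr addrACA. Qed.

Lemma DeltaD_linear u : linear (DeltaD u).
Proof. by move=> c x y; rewrite /Defs.DeltaD !linearP scalerDr addrACA. Qed.

HB.instance Definition _ u := GRing.isLinear.Build C _ _ _ _ (DeltaB_linear u).
HB.instance Definition _ u := GRing.isLinear.Build C _ _ _ _ (DeltaC_linear u).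
HB.instance Definition _ u := GRing.isLinear.Build C _ _ _ _ (DeltaD_linear u).

End Operators.

(** * Recursions for the coefficients *)

Section Coefficients.
Context (F : numFieldType) (eta mu : F) (G : F -> F).
Implicit Types (x y : F) (n : nat).

(* For mu = 2 lam1 and G = g this is the coefficient of |l+n,k-n> in
   v_{lk} / q_{lk}, at x = l and y = k; keeping x and y in F avoids truncated
   subtraction. *)
Definition coef x y n : F :=
  \prod_(i < n) (- eta / i.+1%:R * (mu - x - i%:R) * (y - i%:R)
                 / G (y - x - i.+1%:R)).

Lemma coef0 x y : coef x y 0 = 1.
Proof. exact: big_ord0. Qed.

Lemma coefS x y n : coef x y n.+1 =
  coef x y n * (- eta / n.+1%:R * (mu - x - n%:R) * (y - n%:R)
                / G (y - x - n.+1%:R)).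
Proof. exact: big_ord_recr. Qed.

(* The junk value 1 / 0 = 0 is harmless here: both sides are the same product
   of inverses, so no G needs to be nonzero. *)
Lemma coef_shiftl x y n :
  (mu - x) / G (y - x - 1) * coef (x + 1) y n =
  coef x y n * ((mu - x - n%:R) / G (y - x - n.+1%:R)).
Proof.
elim: n => [|n IHn]; first by rewrite !coef0 subr0 mulr1 mul1r.
rewrite !coefS mulrA IHn.
have -> : y - (x + 1) - n.+1%:R = y - x - n.+2%:R by ring.
have -> : mu - (x + 1) - n%:R = mu - x - n.+1%:R by ring.
by move: (G _)^-1 (G _)^-1 n.+1%:R^-1 => p q r; ring.
Qed.

(** Lowering [y] moves the factors [y - i] and the arguments of [G] one step along, so the two
    products differ only in their end factors. *)
Lemma coef_shiftr x y n :
  y / G (y - x - 1) * coef x (y - 1) n =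
  coef x y n * ((y - n%:R) / G (y - x - n.+1%:R)).
Proof.
elim: n => [|n IHn]; first by rewrite !coef0 subr0 mulr1 mul1r.
rewrite !coefS mulrA IHn.
have -> : y - 1 - x - n.+1%:R = y - x - n.+2%:R by ring.
have -> : y - 1 - n%:R = y - n.+1%:R by ring.
by move: (G _)^-1 (G _)^-1 n.+1%:R^-1 => p q r; ring.
Qed.

(** Taken at [x - 1], this expresses [coef (x - 1) y n.+1] through [coef x y n]; [coefS_shiftr]
    serves likewise at [y + 1]. *)
Lemma coefS_shiftl x y n : coef x y n.+1 =
  - eta / n.+1%:R * (y - n%:R) * ((mu - x) / G (y - x - 1)) * coef (x + 1) y n.
Proof.
rewrite -(mulrA (- eta / _ * _)) coef_shiftl coefS.
by move: (G _)^-1 n.+1%:R^-1 => p r; ring.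
Qed.

Lemma coefS_shiftr x y n : coef x y n.+1 =
  - eta / n.+1%:R * (mu - x - n%:R) * (y / G (y - x - 1)) * coef x (y - 1) n.
Proof.
rewrite -(mulrA (- eta / _ * _)) coef_shiftr coefS.
by move: (G _)^-1 n.+1%:R^-1 => p r; ring.
Qed.

End Coefficients.

(** * Rational identities behind the three formulas *)

Section CoefficientIdentities.
Context (F : numFieldType) (eta lam1 lam2 del1 del2 : F).
Implicit Types (x y u : F) (n : nat).
Let G x := del1 - del2 + eta * (lam1 - lam2 + x).
Local Notation coef := (coef eta (2 * lam1) G).

(* Coefficients of |l+n+1,k-n-1>, |l+n+1,k-n> and |l+n,k-n-1> respectively. *)
Lemma coef_DeltaD x y u n : G (y - x - n.+1%:R) != 0 ->
  coef x y n * (eta ^+ 2 * (2 * lam1 - (x + n%:R)) * (y - n%:R))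
  + coef x y n.+1 * ((u - del1 - eta * (lam1 - (x + n.+1%:R)))
                     * (u - del2 - eta * (lam2 - (y - n.+1%:R))))
  = (u - del1 - eta * (lam1 - x)) * (u - del2 - eta * (lam2 - y))
    * coef x y n.+1.
Proof.
have n0 : n.+1%:R != 0 :> F by rewrite pnatr_eq0.
rewrite coefS; move: n0 (coef x y n) => + c.
rewrite -natr1 /G => n0 g0; by field; rewrite n0 g0.
Qed.

Lemma coef_DeltaB x y u n : G (y - x) != 0 -> G (y - x - n.+1%:R) != 0 ->
  coef x y n * (eta * (2 * lam1 - (x + n%:R))
                * (u - del2 + eta * (lam2 - (y - n%:R))))
  + coef x y n.+1 * (eta * (u - del1 - eta * (lam1 - (x + n.+1%:R)))
                     * (2 * lam2 - (y - n.+1%:R)))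
  = eta * (u - del2 - eta * (lam2 - y)) * (G (2 * lam2 - x) / G (y - x))
    * (G (- (x + 1)) * ((2 * lam1 - x) / G (y - x - 1) * coef (x + 1) y n))
  + eta * (u - del1 - eta * (lam1 - x)) * (2 * lam2 - y)
    * coef x (y + 1) n.+1.
Proof.
have n0 : n.+1%:R != 0 :> F by rewrite pnatr_eq0.
(* Every coefficient becomes a multiple of [coef x y n], then generalized to [c]; a rational
   identity remains. *)
rewrite coef_shiftl (coefS_shiftr _ _ _ _ (y + 1)) addrK coefS.
move: n0 (coef x y n) => + c.
have -> : y + 1 - x - 1 = y - x by ring.
rewrite -natr1 /G => n0 g1 g2; by field; rewrite n0 g1 g2.
Qed.

Lemma coef_DeltaC x y u n : G (y - x) != 0 -> G (y - x - n.+1%:R) != 0 ->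
  coef x y n * (eta * (u - del1 + eta * (lam1 - (x + n%:R))) * (y - n%:R))
  + coef x y n.+1 * (eta * (x + n.+1%:R)
                     * (u - del2 - eta * (lam2 - (y - n.+1%:R))))
  = eta * (u - del2 - eta * (lam2 - y)) * (x * coef (x - 1) y n.+1)
  + eta * (u - del1 - eta * (lam1 - x)) * (G y / G (y - x))
    * (G (- 2 * lam1 + (y - 1)) * (y / G (y - x - 1) * coef x (y - 1) n)).
Proof.
have n0 : n.+1%:R != 0 :> F by rewrite pnatr_eq0.
rewrite coef_shiftr (coefS_shiftl _ _ _ (x - 1)) subrK coefS.
move: n0 (coef x y n) => + c.
have -> : y - (x - 1) - 1 = y - x by ring.
rewrite -natr1 /G => n0 g1 g2; by field; rewrite n0 g1 g2.
Qed.

End CoefficientIdentities.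

(** * Action on the vectors before normalization *)

Section Eigenvectors.
Context (R : realType) (eta lam1 lam2 del1 del2 : R[i]).
Local Notation g := (g eta lam1 lam2 del1 del2).
Local Notation DeltaB := (DeltaB eta lam1 lam2 del1 del2).
Local Notation DeltaC := (DeltaC eta lam1 lam2 del1 del2).
Local Notation DeltaD := (DeltaD eta lam1 lam2 del1 del2).
Local Notation d1 := (d eta lam1 del1).
Local Notation d2 := (d eta lam2 del2).
Local Notation ket2 := (ket2 lam1 lam2).
Local Notation coef := (coef eta (2 * lam1) g).

(** No membership test is built in, so the formulas for [w] hold without cases at the boundary of
    the index set. *)
Definition w l k : tensor lam1 lam2 :=
  \sum_(n < k.+1) coef l%:R k%:R n *: ket2 (l + n) (k - n).

(** Leaving [K lam1] means passing its last index, where [f_last] makes a factor of the product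
    zero. *)
Lemma coef_eq0l l n (y : R[i]) :
  K lam1 l -> ~~ K lam1 (l + n)%N -> coef l%:R y n = 0.
Proof.
move=> Kl; elim: n => [|n IHn]; first by rewrite addn0 Kl.
rewrite coefS; have [Kn|/IHn->] := boolP (K lam1 (l + n)%N); last by rewrite mul0r.
rewrite addnS -addrA -opprD -natrD => /(f_last Kn); rewrite /f => ->.
by rewrite mulr0 !mul0r mulr0.
Qed.

Lemma coef_eq0r (x : R[i]) k : coef x k%:R k.+1 = 0.
Proof. by rewrite coefS subrr mulr0 mul0r mulr0. Qed.

Lemma v_w q l k : K lam1 l -> K lam2 k ->
  v eta lam1 lam2 del1 del2 q l k = q l k *: w l k.
Proof.
move=> Kl Kk; rewrite /v Kl Kk; congr (_ *: _).
rewrite big_mkord; apply: eq_bigr => -[n /= n_lt] _; congr (_ *: _).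
rewrite big_add1 /= big_mkord.
elim: n n_lt => [|n IHn] n_lt.
  by rewrite coef0 big_ord0 expr0 fact0 divr1 mul1r.
rewrite coefS -IHn ?(ltnW n_lt) // big_ord_recr /= exprS factS natrM invfM.
have -> : f lam1 (l + n.+1 - 1) = 2 * lam1 - l%:R - n%:R.
  by rewrite /f addnS subn1 natrD opprD addrA.
(* The bound [n_lt] makes the truncated subtraction exact. *)
have -> : e R (k - n.+1 + 1) = k%:R - n%:R.
  by rewrite /e addn1 -subSn // subSS natrB // ltnW.
by move: (\prod_(_ < n) _) (g _)^-1 n.+1%:R^-1 n`!%:R^-1 => p r s t; ring.
Qed.

(** Terms with [l + n] outside [K lam1] have coefficient 0 by [coef_eq0l], so [h'] is unconstrained
    there. *)
Lemma w_linear (h : {linear tensor lam1 lam2 -> tensor lam1 lam2})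
    (h' : nat -> tensor lam1 lam2) l k :
  K lam1 l ->
  (forall n, (n <= k)%N -> K lam1 (l + n)%N -> h (ket2 (l + n) (k - n)) = h' n) ->
  h (w l k) = \sum_(n < k.+1) coef l%:R k%:R n *: h' n.
Proof.
move=> Kl hE; rewrite /w linear_sum; apply: eq_bigr => -[n /= n_le] _.
rewrite linearZ /=; have [Kn|nK] := boolP (K lam1 (l + n)%N); first by rewrite hE.
by rewrite coef_eq0l // !scale0r.
Qed.

Lemma DeltaD_w u l k : K lam1 l -> K lam2 k ->
  (forall n, (n < k)%N -> K lam1 (l + n.+1)%N -> g (k%:R - l%:R - n.+1%:R) != 0) ->
  DeltaD u (w l k) = (d1 l u * d2 k u) *: w l k.
Proof.
move=> Kl Kk g0.
rewrite (w_linear (h' := fun n =>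
    (eta ^+ 2 * (2 * lam1 - (l%:R + n%:R)) * (k%:R - n%:R))
      *: ket2 (l + n.+1) (k - n.+1)
  + ((u - del1 - eta * (lam1 - (l%:R + n%:R)))
      * (u - del2 - eta * (lam2 - (k%:R - n%:R)))) *: ket2 (l + n) (k - n))) //;
  last first.
  move=> n nk Kn /=; rewrite DeltaD_ket2 //; last exact: K_leq (leq_subr _ _) Kk.
  by rewrite /f /d natrD natrB // addnS subnS.
under eq_bigr do rewrite scalerDr !scalerA.
(* The raising family vanishes at [n = k] through [k - n]. Splitting off [n = 0] from the diagonal
   family then aligns both on |l+n+1,k-n-1>. *)
rewrite big_split /= big_ord_recr /= subrr !mulr0 scale0r addr0.
rewrite big_ord_recl addrCA -big_split /= /w scaler_sumr [in RHS]big_ord_recl.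
congr (_ + _).
  by rewrite scalerA coef0 mul1r mulr1 addr0 subr0.
apply: eq_bigr => -[n nk] _; rewrite /= -scalerDl [RHS]scalerA.
(* The condition [g0] is available only inside [K lam1]; outside, the vector itself is 0. *)
have [Kn|nK] := boolP (K lam1 (l + n.+1)%N); last by rewrite ket2_0l ?scaler0.
by congr (_ *: _); apply: coef_DeltaD; apply: g0.
Qed.

(** The first coefficient contains [g (- l.+1%:R) / g (k%:R - l.+1%:R)], the ratio q_{l+1,k} /
    q_{lk}; in the second, the ratio of the q has cancelled the quotient of [g]. *)
Lemma DeltaB_w u l k : K lam1 l -> K lam2 k -> g (k%:R - l%:R) != 0 ->
  (forall n, (n <= k)%N -> K lam1 (l + n.+1)%N -> g (k%:R - l%:R - n.+1%:R) != 0) ->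
  DeltaB u (w l k) =
    (eta * d2 k u * (g (2 * lam2 - l%:R) / g (k%:R - l%:R))
       * (g (- l.+1%:R) * (f lam1 l / g (k%:R - l.+1%:R)))) *: w l.+1 k
  + (eta * d1 l u * f lam2 k) *: w l k.+1.
Proof.
move=> Kl Kk g1 g2.
rewrite (w_linear (h' := fun n =>
    (eta * (2 * lam1 - (l%:R + n%:R)) * (u - del2 + eta * (lam2 - (k%:R - n%:R))))
      *: ket2 (l + n.+1) (k.+1 - n.+1)
  + (eta * (u - del1 - eta * (lam1 - (l%:R + n%:R))) * (2 * lam2 - (k%:R - n%:R)))
      *: ket2 (l + n) (k.+1 - n))) //;
  last first.
  move=> n nk Kn /=; rewrite DeltaB_ket2 //; last exact: K_leq (leq_subr _ _) Kk.
  by rewrite /f /d /a natrD natrB // addnS subSS subSn.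
under eq_bigr do rewrite scalerDr !scalerA.
pose Q n := (coef l%:R k%:R n
  * (eta * (u - del1 - eta * (lam1 - (l%:R + n%:R))) * (2 * lam2 - (k%:R - n%:R))))
  *: ket2 (l + n) (k.+1 - n).
(* The sum is extended to the range of [w l k.+1]. At [n = k.+1] the vector may be nonzero, but its
   coefficient is 0. *)
have QE : \sum_(n < k.+2) Q n = \sum_(n < k.+1) Q n.
  by rewrite big_ord_recr /= /Q coef_eq0r mul0r scale0r addr0.
rewrite big_split /= -[X in _ + X]/(\sum_(n < k.+1) Q n) -QE /Q.
rewrite [X in _ + X]big_ord_recl addrCA -big_split /=.
rewrite [in RHS]/w !scaler_sumr [X in _ = _ + X]big_ord_recl [in RHS]addrCA.
congr (_ + _).
  by rewrite scalerA !coef0 mul1r mulr1 addr0 subr0.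
rewrite -big_split /=.
apply: eq_bigr => -[n nk] _; rewrite /= -scalerDl !scalerA subSS addSnnS.
rewrite -scalerDl.
have [Kn|nK] := boolP (K lam1 (l + n.+1)%N); last by rewrite ket2_0l ?scaler0.
apply: (congr1 (fun c => c *: _)).
rewrite /bump /= add1n [LHS](coef_DeltaB u g1 (g2 n nk Kn)).
rewrite -[l.+1%:R]natr1 -[k.+1%:R]natr1.
have -> : k%:R - (l%:R + 1) = k%:R - l%:R - 1 :> R[i] by ring.
by congr (_ + _); rewrite /f /d !mulrA.
Qed.

(** The roles are exchanged: the ratio of the q has cancelled in the first term, and in the second
    q_{l,k-1} / q_{lk} appears explicitly. *)
Lemma DeltaC_w u l k : K lam1 l -> K lam2 k -> g (k%:R - l%:R) != 0 ->
  (forall n, (n < k)%N -> K lam1 (l + n)%N -> g (k%:R - l%:R - n.+1%:R) != 0) ->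
  DeltaC u (w l k) =
    (eta * d2 k u * l%:R) *: w l.-1 k
  + (eta * d1 l u * (g k%:R / g (k%:R - l%:R))
      * (g (- 2 * lam1 + k.-1%:R) * (k%:R / g (k.-1%:R - l%:R)))) *: w l k.-1.
Proof.
move=> Kl Kk g1 g2.
(* This is |l+n-1,k-n>; truncation at [l = n = 0] is harmless, since the coefficient [l + n] is then
   0. *)
pose y n := ket2 (l + n).-1 (k - n).
rewrite (w_linear (h' := fun n =>
    (eta * (u - del1 + eta * (lam1 - (l%:R + n%:R))) * (k%:R - n%:R)) *: y n.+1
  + (eta * (l%:R + n%:R) * (u - del2 - eta * (lam2 - (k%:R - n%:R)))) *: y n)) //;
  last first.
  move=> n nk Kn /=; rewrite DeltaC_ket2 //; last exact: K_leq (leq_subr _ _) Kk.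
  by rewrite /y /f /d /a natrD natrB // addnS subnS.
have -> : (eta * d2 k u * l%:R) *: w l.-1 k = \sum_(n < k.+1)
    (eta * d2 k u * (l%:R * coef (l%:R - 1) k%:R n)) *: y n.
  case: l => [|l] in Kl g1 g2 y *.
    rewrite mulr0 scale0r big1 // => i _.
    by rewrite mul0r mulr0 scale0r.
  have -> : l.+1%:R - 1 = l%:R :> R[i] by rewrite -natr1 addrK.
  rewrite /w scaler_sumr; apply: eq_bigr => n _.
  by rewrite /y addSn scalerA mulrA.
have -> : (eta * d1 l u * (g k%:R / g (k%:R - l%:R))
      * (g (- 2 * lam1 + k.-1%:R) * (k%:R / g (k.-1%:R - l%:R)))) *: w l k.-1 =
   \sum_(n < k)
    (eta * d1 l u * (g k%:R / g (k%:R - l%:R))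
     * (g (- 2 * lam1 + (k%:R - 1))
        * (k%:R / g (k%:R - l%:R - 1) * coef l%:R (k%:R - 1) n))) *: y n.+1.
  case: k => [|k] in Kk g1 g2 y *.
    by rewrite big_ord0 mul0r !mulr0 scale0r.
  have -> : k.+1%:R - 1 = k%:R :> R[i] by rewrite -natr1 addrK.
  have -> : k.+1%:R - l%:R - 1 = k%:R - l%:R :> R[i] by rewrite -natr1; ring.
  rewrite /w scaler_sumr; apply: eq_bigr => n _.
  by rewrite /y addnS subSS scalerA !mulrA.
under eq_bigr do rewrite scalerDr !scalerA.
rewrite big_split /= big_ord_recr /= subrr !mulr0 scale0r addr0.
rewrite [X in _ + X]big_ord_recl addrCA -big_split /=.
rewrite [X in _ = X + _]big_ord_recl -[RHS]addrA -big_split /=.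
congr (_ + _).
  by rewrite !coef0 mul1r mulr1 addr0 subr0 mulrAC.
apply: eq_bigr => -[n nk] _; rewrite /= -!scalerDl.
have [Kn|nK] := boolP (K lam1 (l + n)%N); last by rewrite /y addnS ket2_0l ?scaler0.
apply: (congr1 (fun c => c *: _)).
rewrite /bump /= add1n [LHS](coef_DeltaC u g1 (g2 n nk Kn)).
by congr (_ + _).
Qed.

End Eigenvectors.

(** * Normalization by [q] and boundary indices *)

Theorem proposition4p1 (R : realType) (eta lam1 lam2 del1 del2 : R[i])
    (q : nat -> nat -> R[i]) :
  let g := g eta lam1 lam2 del1 del2 in
  let v := v eta lam1 lam2 del1 del2 q in
  eta != 0 ->
  (forall l k : nat, K lam1 l -> K lam2 k -> g (k%:R - l%:R) != 0) ->
  (forall l k n : nat, (1 <= n)%N -> (n <= k)%N ->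
     K lam1 l -> K lam2 k -> K lam1 (l + n)%N -> K lam2 (k - n)%N ->
     g (k%:R - l%:R - n%:R) != 0) ->
  (forall k : nat, K lam2 k -> K lam2 k.+1 -> g (- 2 * lam1 + k%:R) != 0) ->
  (forall l k : nat, K lam1 l -> K lam2 k -> q l k != 0) ->
  (forall l k : nat, K lam1 l -> K lam1 l.+1 -> K lam2 k ->
     q l.+1 k / q l k = g (- l.+1%:R) / g (k%:R - l.+1%:R)) ->
  (forall l k : nat, K lam1 l -> K lam2 k -> K lam2 k.+1 ->
     q l k.+1 / q l k = g (k%:R - l%:R) / g (- 2 * lam1 + k%:R)) ->
  forall (u : R[i]) (l k : nat), K lam1 l -> K lam2 k ->
  [/\ DeltaD eta lam1 lam2 del1 del2 u (v l k) =
        (d eta lam1 del1 l u * d eta lam2 del2 k u) *: v l k,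
      DeltaB eta lam1 lam2 del1 del2 u (v l k) =
        (eta * f lam1 l * d eta lam2 del2 k u *
           (g (2 * lam2 - l%:R) / g (k%:R - l%:R))) *: v l.+1 k +
        (eta * d eta lam1 del1 l u * f lam2 k *
           (g (- 2 * lam1 + k%:R) / g (k%:R - l%:R))) *: v l k.+1
    & DeltaC eta lam1 lam2 del1 del2 u (v l k) =
        (eta * e R l * d eta lam2 del2 k u *
           (g (- l%:R) / g (k%:R - l%:R))) *: v l.-1 k +
        (eta * d eta lam1 del1 l u * e R k *
           (g k%:R / g (k%:R - l%:R))) *: v l k.-1].
Proof.
move=> g v _ g_neq0 g_shift_neq0 g_lam_neq0 q_neq0 q_recl q_recr u l k Kl Kk.
have q_l l' : K lam1 l' -> K lam1 l'.+1 ->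
    q l'.+1 k = q l' k * (g (- l'.+1%:R) / g (k%:R - l'.+1%:R)).
  by move=> Kl' KSl'; rewrite -q_recl // mulrC divfK ?q_neq0.
have q_r k' : K lam2 k' -> K lam2 k'.+1 ->
    q l k'.+1 = q l k' * (g (k'%:R - l%:R) / g (- 2 * lam1 + k'%:R)).
  by move=> Kk' KSk'; rewrite -q_recr // mulrC divfK ?q_neq0.
have g0 := g_neq0 l k Kl Kk.
rewrite /v [in DeltaD _ _ _ _ _ _ _]v_w // [in DeltaB _ _ _ _ _ _ _]v_w //.
rewrite [in DeltaC _ _ _ _ _ _ _]v_w // !linearZ /=; split.
- rewrite v_w // DeltaD_w // => [|n nk Kn]; last first.
    by apply: g_shift_neq0 => //; apply: K_leq (leq_subr _ _) Kk.
  by rewrite !scalerA mulrC.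
- rewrite DeltaB_w -/g // => [|n nk Kn]; last first.
    (* The condition is read from the pair (l+1,k) shifted by [n]: starting from (l,k), the shift
       [n + 1] could exceed [k]. *)
    case: n nk Kn => [|n] nk Kn.
      have -> : k%:R - l%:R - 1 = k%:R - l.+1%:R :> R[i] by rewrite -natr1; ring.
      by apply: g_neq0 => //; rewrite -addn1.
    have -> : k%:R - l%:R - n.+2%:R = k%:R - l.+1%:R - n.+1%:R :> R[i].
      by rewrite -!natr1; ring.
    apply: g_shift_neq0 => //; last exact: K_leq (leq_subr _ _) Kk.
      by apply: K_leq Kn; rewrite addnS ltnS leq_addr.
    by rewrite addSnnS.
  rewrite scalerDr !scalerA; congr (_ + _).
    (* At the last index [f lam1 l] is 0, so both sides vanish. *)
    have [KSl|nKSl] := boolP (K lam1 l.+1); last first.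
      by rewrite f_last // !(mul0r, mulr0) !scale0r.
    rewrite v_w // scalerA q_l //; congr (_ *: _).
        by move: (_^-1) (_^-1) => r s; ring.
  have [KSk|nKSk] := boolP (K lam2 k.+1); last first.
    by rewrite f_last // !(mul0r, mulr0) !scale0r.
  rewrite v_w // scalerA q_r //; congr (_ *: _).
  have gl := g_lam_neq0 k Kk KSk.
  by field; rewrite gl g0.
rewrite DeltaC_w -/g // => [|n nk Kn]; last first.
  (* Here the pair (l,k-1) shifted by [n] is used, as only [l + n] is known to lie in [K lam1]. *)
  case: n nk Kn => [|n] nk Kn.
    case: k nk {q_l q_r g0} Kk => [//|k] _ Kk.
    have -> : k.+1%:R - l%:R - 1 = k%:R - l%:R :> R[i] by rewrite -natr1; ring.
    by apply: g_neq0 => //; apply: K_leq Kk.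
  case: k nk {q_l q_r g0} Kk => [//|k] nk Kk.
  have Kk' : K lam2 k by apply: K_leq Kk.
  have -> : k.+1%:R - l%:R - n.+2%:R = k%:R - l%:R - n.+1%:R :> R[i].
    by rewrite -!natr1; ring.
  by apply: g_shift_neq0 => //; apply: K_leq (leq_subr _ _) Kk'.
rewrite scalerDr !scalerA; congr (_ + _).
  (* At [l = 0] the truncated [v l.-1 k] may be nonzero; the factor [e R 0] removes it. *)
  case: l Kl g0 q_l {q_r} => [|l] Kl g0 q_l.
    by rewrite /e !(mul0r, mulr0) !scale0r.
  have Kl' : K lam1 l by apply: K_leq Kl.
  rewrite v_w // scalerA q_l //; congr (_ *: _); rewrite /e.
  by move: (_^-1) => r; ring.
case: k Kk g0 q_r {q_l} => [|k] Kk g0 q_r.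
  by rewrite /e !(mul0r, mulr0) !scale0r.
have Kk' : K lam2 k by apply: K_leq Kk.
rewrite v_w // scalerA q_r //; congr (_ *: _); rewrite /e.
(* The recursion is used backwards, so both the numerator and the denominator of its quotient must
   cancel. *)
have gl := g_lam_neq0 k Kk' Kk; have gk := g_neq0 l k Kl Kk'.
by field; rewrite gl gk g0.
Qed.
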